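(* Let $\alpha\in(1,2)$ and $\varsigma_\alpha=|\cos(\frac{\alpha}{2}\pi)|$. Assume: (i) for any $x\in(x_L,x_R)$, $d(x)\in[\kappa_{\min},\kappa_{\max}]$ for positive constants $\kappa_{\min}$ and $\kappa_{\max}$; (ii) $\kappa_{\min}-\nu_\alpha>0$, where $\nu_\alpha=\sqrt2(\kappa_{\max}-\kappa_{\min})/\varsigma_\alpha$; (iii) $d$ is convex. Then, for any integers $N\ge1$ and $M\ge1$, $\Sigma^2(\mathbf{A}\mathbf{P}^{-1})\subset[\check s,\hat s]$, and thus $$\sup_{N,M\ge1}\mathrm{cond}(\mathbf{A}\mathbf{P}^{-1})\le\sqrt{\hat s/\check s},$$ where $\check s$ and $\hat s$ are the positive constants, independent of $\tau$ and $h$, given by $$\check s=\min\left\{\frac{\kappa_{\min}-\nu_\alpha}{\kappa_{\max}},\frac{\kappa_{\min}^2}{\kappa_{\max}^2}\right\},\qquad \hat s=\max\left\{\frac{\kappa_{\min}+\nu_\alpha}{\kappa_{\min}},\frac{\kappa_{\max}^2}{\kappa_{\min}^2}\right\}.$$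
   Context: Let $x_L<x_R$, $T>0$, $h=(x_R-x_L)/(M+1)$, $\tau=T/N$, $x_i=x_L+ih$. Define $g_0^{(\alpha)}=1$, $g_k^{(\alpha)}=\left(1-\frac{\alpha+1}{k}\right)g_{k-1}^{(\alpha)}$ for $k\ge1$, and $w_0^{(\alpha)}=\frac{\alpha}{2}g_0^{(\alpha)}$, $w_k^{(\alpha)}=\frac{\alpha}{2}g_k^{(\alpha)}+\frac{2-\alpha}{2}g_{k-1}^{(\alpha)}$ for $k\ge1$. $G_\alpha\in\mathbb{R}^{M\times M}$ is the Toeplitz matrix whose $(i,j)$ entry is $w_{i-j+1}^{(\alpha)}$ if $i-j+1\ge0$ and $0$ otherwise. $D=\mathrm{diag}(d(x_1),\dots,d(x_M))$ and $\bar d=\frac1M\sum_{i=1}^M d(x_i)$. With $\eta=\tau/(2h^\alpha)$ and $I_M$ the identity matrix, $\mathbf{A}=I_M-\eta DG_\alpha$ and $\mathbf{P}=I_M-\eta\bar d\,G_\alpha$ (the Toeplitz preconditioner). $\Sigma(\mathbf{C})$ is the set of singular values of $\mathbf{C}$, $\Sigma^2(\mathbf{C})=\{x^2: x\in\Sigma(\mathbf{C})\}$, and $\mathrm{cond}(\mathbf{C})=\|\mathbf{C}\|_2\|\mathbf{C}^{-1}\|_2$. *)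

(* Defs.v *)
From HB Require Import structures.
From mathcomp Require Import all_boot all_order all_algebra.
From mathcomp Require Import all_classical all_reals all_analysis.

Set Implicit Arguments.
Unset Strict Implicit.
Unset Printing Implicit Defensive.

Import Order.TTheory GRing.Theory Num.Theory.
Import numFieldNormedType.Exports.

Local Open Scope classical_set_scope.
Local Open Scope ring_scope.

Definition l2norm (R : realType) (n : nat) (v : 'cV[R]_n) : R :=
  Num.sqrt (\sum_(i < n) v i ord0 ^+ 2).

(* The matrix norm induced by the Euclidean norm. The library norm `|C| on
   matrices is the max-norm, hence not used here. *)
Definition norm2 (R : realType) (n : nat) (C : 'M[R]_n) : R :=
  sup [set l2norm (C *m v) | v in [set v : 'cV[R]_n | l2norm v = 1]].

(* [invmx C] is the inverse only when [C \in unitmx]. *)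
Definition cond2 (R : realType) (n : nat) (C : 'M[R]_n) : R :=
  norm2 C * norm2 (invmx C).

(* C^T C is real symmetric, so all its eigenvalues lie in R. *)
Definition singular_values (R : realType) (n : nat) (C : 'M[R]_n) : set R :=
  [set Num.sqrt l | l in [set l : R | eigenvalue (C^T *m C) l]].

Definition sq_singular_values (R : realType) (n : nat) (C : 'M[R]_n) : set R :=
  [set x ^+ 2 | x in singular_values C].

Fixpoint gcoef (R : realType) (alpha : R) (k : nat) : R :=
  match k with
  | 0%N => 1
  | k'.+1 => (1 - (alpha + 1) / k'.+1%:R) * gcoef alpha k'
  end.

Definition wcoef (R : realType) (alpha : R) (k : nat) : R :=
  match k with
  | 0%N => alpha / 2 * gcoef alpha 0
  | k'.+1 => alpha / 2 * gcoef alpha k'.+1 + (2 - alpha) / 2 * gcoef alpha k'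
  end.

Section Discretization.
Variables (R : realType) (xL xR T alpha : R) (d : R -> R).

Definition hstep (M : nat) : R := (xR - xL) / M.+1%:R.

Definition taustep (N : nat) : R := T / N%:R.

Definition grid (M i : nat) : R := xL + i%:R * hstep M.

(* Indices in 'I_M start at 0: row i stands for the node x_(i+1). *)
Definition Gmx (M : nat) : 'M[R]_M :=
  \matrix_(i, j) (if (j <= i.+1)%N then wcoef alpha (i.+1 - j)%N else 0).

Definition Dmx (M : nat) : 'M[R]_M := diag_mx (\row_(i < M) d (grid M i.+1)).

Definition dbar (M : nat) : R := (\sum_(1 <= i < M.+1) d (grid M i)) / M%:R.

Definition etapar (N M : nat) : R := taustep N / (2 * hstep M `^ alpha).

Definition Amx (N M : nat) : 'M[R]_M :=
  1%:M - etapar N M *: (Dmx M *m Gmx M).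

Definition Pmx (N M : nat) : 'M[R]_M :=
  1%:M - (etapar N M * dbar M) *: Gmx M.

Definition APinv (N M : nat) : 'M[R]_M := Amx N M *m invmx (Pmx N M).

End Discretization.

Definition varsigma (R : realType) (alpha : R) : R := `|cos (alpha / 2 * pi)|.

Definition nucoef (R : realType) (alpha kmin kmax : R) : R :=
  Num.sqrt 2 * (kmax - kmin) / varsigma alpha.

Definition scheck (R : realType) (alpha kmin kmax : R) : R :=
  Num.min ((kmin - nucoef alpha kmin kmax) / kmax) (kmin ^+ 2 / kmax ^+ 2).

Definition shat (R : realType) (alpha kmin kmax : R) : R :=
  Num.max ((kmin + nucoef alpha kmin kmax) / kmin) (kmax ^+ 2 / kmin ^+ 2).

(* Main.v *)
Require Import Defs.
From mathcomp Require Import all_boot all_order all_algebra.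
From mathcomp Require Import all_classical all_reals all_analysis.
From mathcomp Require Import ring lra zify.

Set Implicit Arguments.
Unset Strict Implicit.
Unset Printing Implicit Defensive.

Import Order.TTheory GRing.Theory Num.Theory.
Import numFieldNormedType.Exports.

Local Open Scope classical_set_scope.
Local Open Scope ring_scope.

(** Write E(y) = - <y, G y>, where <., .> is the Euclidean product and G the
    Toeplitz matrix. Expanding the squares,
      |A y|^2 = |y|^2 - 2 eta <y, D G y> + eta^2 |D G y|^2,
      |P y|^2 = |y|^2 + 2 eta dbar E(y) + eta^2 dbar^2 |G y|^2,
    and both sides can be compared term by term. The last terms only need
    d and dbar to lie in [kmin, kmax]. For the middle terms,
      - <y, D G y> = kmin E(y) - <(D - kmin) y, G y>,
    so it suffices that |<(D - kmin) y, G y>| <= nu E(y)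
    ([toeplitz_form_multiplier]). The ratio |A y|^2 / |P y|^2 then lies between
    the two constants, and so do the squared singular values of A P^-1 and the
    squared norms that enter its condition number.

    The middle estimate combines two properties of G.

    Sectoriality ([toeplitz_form_sector]). In the variable t = (theta - pi) / 2,
    ranging over [-pi/2, pi/2], one has
      (1 - e^(i theta))^alpha = (2 cos t)^alpha e^(i alpha t),
    so the symbol of - G is a nonnegative multiple of
      p + i r = (alpha/2) e^(i (alpha - 2) t) - ((2 - alpha)/2) e^(i alpha t),
    which stays in the sector |r| varsigma <= p sin((2 - alpha) pi / 2)
    ([symbol_sector]). Hence varsigma |<x, G y>| <= sqrt (E(x) E(y)). That G has
    this symbol is read off the moments
      I(b) = integral over [-pi/2, pi/2] of (cos t)^alpha cos(b t) dt:
    integrating the derivative of (cos t)^(alpha + 1) sin((b + 1) t) gives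
    (alpha - b) I(b) = (alpha + b + 2) I(b + 2), which at b = alpha - 2 k is the
    recurrence that defines the coefficients g_k, up to sign ([cos_moment_rec]).

    Dirichlet form ([dirichlet_convex_multiplier]). The symmetric part of - G
    has nonpositive off-diagonal entries and nonnegative row sums. Multiplying y
    by samples e_i in [0, K] of a convex function multiplies E(y) by at most
    2 K^2: convexity controls a symmetric pair of neighbours of i, and the
    remaining one-sided neighbours are paid for by the row sum at i.

    With K = kmax - kmin, the factor sqrt 2 K of the second property and the
    factor 1 / varsigma of the first make up nu. *)

(** * Integration over [-pi/2, pi/2] *)

Section HalfPeriodIntegral.
Context {R : realType}.
Implicit Types (f g F : R -> R) (a b t x : R).

Definition half_period_int f : R :=
  \int[@lebesgue_measure R]_(t in `[- (pi / 2), pi / 2]) f t.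

Notation J := half_period_int.

Lemma continuous_add f g : continuous f -> continuous g ->
  continuous (fun t => f t + g t).
Proof. by move=> cf cg t; apply: (@cvgD _ R^o); [exact: cf | exact: cg]. Qed.

Lemma continuous_mul f g : continuous f -> continuous g ->
  continuous (fun t => f t * g t).
Proof. by move=> cf cg t; apply: cvgM; [exact: cf | exact: cg]. Qed.

Lemma continuous_scale a f : continuous f -> continuous (fun t => a * f t).
Proof. by apply: continuous_mul; exact: cst_continuous. Qed.

Lemma continuous_sum (I : finType) (h : I -> R -> R) :
  (forall i, continuous (h i)) -> continuous (fun t => \sum_i h i t).
Proof.
move=> ch t; apply: cvg_big => // [|j _]; last exact: ch.
exact: add_continuous.
Qed.

Lemma half_period_integrable f : continuous f ->
  (@lebesgue_measure R).-integrable `[- (pi / 2), pi / 2] (EFin \o f).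
Proof.
move=> cf; apply: continuous_compact_integrable; first exact: segment_compact.
exact: continuous_subspaceT.
Qed.

Lemma half_period_intD f g : continuous f -> continuous g ->
  J (fun t => f t + g t) = J f + J g.
Proof.
by move=> cf cg; apply: RintegralD => //; exact: half_period_integrable.
Qed.

Lemma half_period_intZ a f : continuous f -> J (fun t => a * f t) = a * J f.
Proof.
by move=> cf; apply: RintegralZl => //; exact: half_period_integrable.
Qed.

Lemma half_period_int0 : J (fun=> 0) = 0.
Proof.
transitivity (J (fun _ : R => 0 * (0 : R))).
  by congr J; apply/funext => t; rewrite mul0r.
by rewrite half_period_intZ ?mul0r //; exact: cst_continuous.
Qed.

Lemma half_period_int_sum (I : finType) (h : I -> R -> R) :
  (forall i, continuous (h i)) ->
  J (fun t => \sum_i h i t) = \sum_i J (h i).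
Proof.
move=> ch; rewrite /index_enum; elim: (Finite.enum I) => [|i s ih].
  rewrite big_nil -[RHS]half_period_int0; congr J.
  by apply/funext => t; rewrite big_nil.
rewrite big_cons -ih -half_period_intD //; last first.
  by move=> t; apply: cvg_big => // [|j _]; [exact: add_continuous | exact: ch].
by congr J; apply/funext => t; rewrite big_cons.
Qed.

Lemma le_half_period_int f g : continuous f -> continuous g ->
  (forall t, - (pi / 2) <= t <= pi / 2 -> f t <= g t) -> J f <= J g.
Proof.
by move=> cf cg fg; apply: le_Rintegral => //; exact: half_period_integrable.
Qed.

(** Differentiability is asked only inside the interval: the primitives used
    below contain powers of the cosine, which vanishes at both ends. *)
Lemma half_period_FTC f F : continuous f -> continuous F ->
  (forall t, - (pi / 2) < t < pi / 2 -> is_derive t 1 F (f t)) ->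
  J f = F (pi / 2) - F (- (pi / 2)).
Proof.
move=> cf cF dF; rewrite /J /half_period_int /Rintegral.
rewrite (@continuous_FTC2 _ f F) //.
- by have := pi_gt0 R; lra.
- exact: continuous_subspaceT.
- split.
  + move=> t; rewrite in_itv/= => ht; have := dF _ ht.
    by move=> ?; exact: ex_derive.
  + exact/cvg_at_right_filter/cF.
  + exact/cvg_at_left_filter/cF.
- move=> t; rewrite in_itv/= => ht; have := dF _ ht => ?.
  by rewrite derive1E derive_val.
Qed.

(** The absolute value is there because the real power is 1 at negative bases,
    so that the power itself is discontinuous at 0. *)
Lemma continuous_norm_powR a : 0 < a -> continuous (fun x : R => `|x| `^ a).
Proof.
move=> a0 x.
have [->|x0] := eqVneq x 0; last first.
  have nx : 0 < `|x| by rewrite normr_gt0.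
  have [dv _] := @is_derive1_powR R a `|x| nx.
  have cp : {for `|x|, continuous (fun y : R => y `^ a)}.
    by apply: differentiable_continuous; exact/derivable1_diffP.
  exact: (@continuous_comp _ _ _ (fun x : R => `|x|) (fun y : R => y `^ a) x
            (@norm_continuous _ _ x) cp).
suff : `|y| `^ a @[y --> (0 : R)] --> (0 : R).
  by rewrite /continuous_at normr0 powR0 ?gt_eqF.
apply/(@cvgrPdist_lt _ R^o) => e e0.
have h : 0 < e `^ a^-1 by rewrite powR_gt0.
near=> y.
rewrite sub0r normrN ger0_norm ?powR_ge0 //.
have -> : e = (e `^ a^-1) `^ a.
  by rewrite -powRrM mulVf ?gt_eqF // powRr1 // ltW.
apply: gt0_ltr_powR => //; rewrite ?nnegrE ?normr_ge0 ?powR_ge0 //.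
Unshelve. all: by end_near. Qed.

End HalfPeriodIntegral.

(** * Cosine moments of a power of the cosine *)

Section CosMoments.
Context {R : realType} (alpha : R).
Implicit Types (b t : R) (k : nat).

Notation J := half_period_int.

Definition cos_weight t : R := `|cos t| `^ alpha.

Definition cos_moment b : R := J (fun t => cos_weight t * cos (b * t)).

Lemma continuous_cosM b : continuous (fun t : R => cos (b * t)).
Proof.
move=> t; apply: (@continuous_comp _ _ _ (fun t : R => b * t) (@cos R)).
  exact: mulrl_continuous.
exact: continuous_cos.
Qed.

Lemma continuous_sinM b : continuous (fun t : R => sin (b * t)).
Proof.
move=> t; apply: (@continuous_comp _ _ _ (fun t : R => b * t) (@sin R)).
  exact: mulrl_continuous.
exact: continuous_sin.
Qed.

Lemma continuous_cos_powR b : 0 < b -> continuous (fun t : R => `|cos t| `^ b).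
Proof.
move=> b0 t.
apply: (@continuous_comp _ _ _ (@cos R) (fun x : R => `|x| `^ b)).
  exact: continuous_cos.
exact: continuous_norm_powR.
Qed.

Lemma continuous_weighted (f : R -> R) : 0 < alpha -> continuous f ->
  continuous (fun t => cos_weight t * f t).
Proof.
by move=> alpha_gt0 cf; apply: continuous_mul => //; exact: continuous_cos_powR.
Qed.

(** Both sides come from integrating the derivative of
    (cos t)^(alpha + 1) sin((b + 1) t), whose boundary values are 0. *)
Lemma cos_moment_rec b : 0 < alpha ->
  (alpha - b) * cos_moment b = (alpha + b + 2) * cos_moment (b + 2).
Proof.
move=> alpha_gt0; pose F (t : R) := `|cos t| `^ (alpha + 1) * sin ((b + 1) * t).
pose f (t : R) := 2^-1 * (b - alpha) * (cos_weight t * cos (b * t)) +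
  2^-1 * (b + alpha + 2) * (cos_weight t * cos ((b + 2) * t)).
have cw x : continuous (fun t => cos_weight t * cos (x * t)).
  by apply: continuous_weighted => //; exact: continuous_cosM.
suff : J f = 0.
  rewrite /f half_period_intD; try exact/continuous_scale/cw.
  by rewrite !half_period_intZ // -/(cos_moment _) -/(cos_moment _); lra.
have <- : F (pi / 2) - F (- (pi / 2)) = 0.
  have a0 : alpha + 1 != 0 by apply: lt0r_neq0; lra.
  by rewrite /F cosN cos_pihalf normr0 powR0 // !mul0r subrr.
refine (@half_period_FTC _ f F _ _ _).
- by apply: continuous_add; exact/continuous_scale/cw.
- apply: continuous_mul; last exact: continuous_sinM.
  exact/continuous_cos_powR/addr_gt0.
- move=> t ht; have c0 := cos_gt0_pihalf ht.
  have near_c : \forall x \near t, 0 < cos x.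
    exact: (cvgr_gt _ (@continuous_cos R t)).
  pose F' (x : R) := cos x `^ (alpha + 1) * sin ((b + 1) * x).
  have FF' : \forall x \near t, F' x = F x.
    by near=> x; rewrite /F/F' gtr0_norm //; near: x.
  refine (near_eq_is_derive (f := F') FF' _).
  have d1 : is_derive t 1 (fun x => cos x `^ (alpha + 1))
      ((alpha + 1) * cos t `^ alpha * - sin t).
    have := @is_derive1_powR R (alpha + 1) _ c0; rewrite addrK => dp.
    exact: (@is_derive1_comp _ (fun y => y `^ (alpha + 1)) cos).
  have d2 : is_derive t 1 (fun x => sin ((b + 1) * x))
      (cos ((b + 1) * t) * (b + 1)).
    apply: (@is_derive1_comp _ sin (fun x => (b + 1) * x)).
    by apply: is_derive_eq; rewrite /GRing.scale/= mulr1.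
  refine (is_derive_eq (is_deriveM d1 d2) _).
  rewrite /f /cos_weight gtr0_norm // /GRing.scale/=.
  rewrite powRD ?powRr1 ?(ltW c0) //; last by apply/implyP => _; rewrite gt_eqF.
  (* the addition formulas at (b + 1) t -/+ t turn the product-rule terms into
     cos(b t) and cos((b + 2) t) *)
  have -> : b * t = (b + 1) * t - t by ring.
  have -> : (b + 2) * t = (b + 1) * t + t by ring.
  by rewrite cosB cosD; field.
Unshelve. all: by end_near. Qed.

(** For |b| <= 1 the integrand dominates (cos t)^3, since cos(b t) >= cos t and
    (cos t)^alpha >= (cos t)^2; the integral of (cos t)^3 is 4/3. *)
Lemma cos_moment_gt0 b : 0 < alpha -> alpha <= 2 -> `|b| <= 1 ->
  0 < cos_moment b.
Proof.
move=> alpha_gt0 alpha2 b1.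
have ccos : continuous (fun t : R => cos t * (1 - sin t ^+ 2)).
  have -> : (fun t : R => cos t * (1 - sin t ^+ 2)) =
      (fun t : R => cos t * (cos t * cos t)).
    by apply/funext => t; rewrite -cos2sin2 expr2.
  by do 2 (apply: continuous_mul; first exact: continuous_cos);
     exact: continuous_cos.
apply: (@lt_le_trans _ _ (J (fun t => cos t * (1 - sin t ^+ 2)))).
  have -> : J (fun t => cos t * (1 - sin t ^+ 2)) = 4 / 3.
    pose F (t : R) := sin t - 3^-1 * (sin t * (sin t * sin t)).
    have <- : F (pi / 2) - F (- (pi / 2)) = 4 / 3.
      by rewrite /F sinN sin_pihalf; lra.
    refine (@half_period_FTC _ _ F ccos _ _) => [|t _].
      apply: continuous_add; first exact: continuous_sin.
      have -> : (fun t : R => - (3^-1 * (sin t * (sin t * sin t)))) =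
          (fun t : R => - 3^-1 * (sin t * (sin t * sin t))).
        by apply/funext => t; rewrite mulNr.
      apply: continuous_scale.
      by do 2 (apply: continuous_mul; first exact: continuous_sin);
         exact: continuous_sin.
    have ds := @is_derive_sin R t.
    have d2 := is_deriveM ds (is_deriveM ds ds).
    have d3 := is_deriveB ds (is_deriveZ 3^-1 d2).
    refine (is_derive_eq d3 _).
    by rewrite /GRing.scale/= -[(sin * sin) t]/(sin t * sin t); field.
  lra.
apply: le_half_period_int => //.
  exact/continuous_weighted/continuous_cosM.
move=> t ht; have c0 := cos_ge0_pihalf ht; have c1 := cos_le1 t.
rewrite -cos2sin2 mulrC.
apply: ler_pM => //; first exact: exprn_ge0.
  rewrite /cos_weight ger0_norm //.
  have [->|ct0] := eqVneq (cos t) 0; first by rewrite expr0n /= powR_ge0.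
  rewrite -powR_mulrn //; apply: ger_powR => //.
  by rewrite c1 andbT lt_neqAle eq_sym ct0.
rewrite -[leLHS]cos_norm -[leRHS]cos_norm.
have pi2 := pi_ge2 R.
have nt : `|t| <= pi / 2 by rewrite ler_norml.
have nbt : `|b * t| <= `|t| by rewrite normrM ler_piMl.
have n0 : 0 <= `|b * t| by [].
rewrite (leNgt (cos `|t|)) ltr_cos ?in_itv/= -?leNgt //; lra.
Qed.

(** The factor cos(alpha t) changes sign on the interval, but one step of the
    recurrence relates this moment to the one at alpha - 2, in (-1, 0). *)
Lemma cos_moment_self_gt0 : 1 < alpha -> alpha < 2 -> 0 < cos_moment alpha.
Proof.
move=> alpha1 alpha2; have alpha_gt0 : 0 < alpha by lra.
have m0 : 0 < cos_moment (alpha - 2).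
  by apply: cos_moment_gt0; rewrite ?(ltW alpha2) //; rewrite ler_norml; lra.
have := cos_moment_rec (alpha - 2) alpha_gt0.
rewrite subrK => e; have : 0 < 2 * alpha * cos_moment alpha by lra.
by rewrite pmulr_rgt0 //; lra.
Qed.

(** The recurrence between b = alpha - 2 (k + 1) and b + 2 is the one that
    defines the coefficients, up to a change of sign at each step. *)
Lemma cos_moment_gcoef k : 1 < alpha ->
  cos_moment (alpha - 2 * k%:R) = (-1) ^+ k * gcoef alpha k * cos_moment alpha.
Proof.
move=> alpha1; elim: k => [|k ih]; first by rewrite mulr0 subr0 expr0 !mul1r.
have k0 : k.+1%:R != 0 :> R by rewrite pnatr_eq0.
have := @cos_moment_rec (alpha - 2 * k.+1%:R) ltac:(lra).
have -> : alpha - 2 * k.+1%:R + 2 = alpha - 2 * k%:R by rewrite -natr1; ring.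
rewrite ih => e /=; apply: (mulfI (_ : 2 * k.+1%:R != 0)).
  by rewrite mulf_neq0.
have -> : 2 * k.+1%:R * cos_moment (alpha - 2 * k.+1%:R) =
  (alpha - (alpha - 2 * k.+1%:R)) * cos_moment (alpha - 2 * k.+1%:R) by ring.
by rewrite e exprS; move: k0; rewrite -natr1 => k0; field.
Qed.

(** At b = alpha the recurrence has a zero factor, which kills every later
    moment: the Fourier coefficients of (1 - e^(i theta))^alpha of negative
    index vanish. *)
Lemma cos_moment_out k : 1 < alpha -> cos_moment (alpha + 2 * k.+1%:R) = 0.
Proof.
move=> alpha1; elim: k => [|k ih].
  have := @cos_moment_rec alpha ltac:(lra); rewrite subrr mul0r mulr1 => /eqP.
  by rewrite eq_sym mulf_eq0 => /orP[/eqP ?|/eqP //]; lra.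
have := @cos_moment_rec (alpha + 2 * k.+1%:R) ltac:(lra); rewrite ih mulr0.
have -> : alpha + 2 * k.+1%:R + 2 = alpha + 2 * k.+2%:R.
  by rewrite -(natr1 k.+1); ring.
move/eqP; rewrite eq_sym mulf_eq0 => /orP[/eqP|/eqP //].
by have := ler0n R k.+1; lra.
Qed.

End CosMoments.

(** * The symbol of the Toeplitz matrix and its sector *)

Section ToeplitzSymbol.
Context {R : realType} (alpha : R).
Implicit Types (t s : R).

Notation lambda := (alpha / 2).
Notation mu := ((2 - alpha) / 2).

(** Indexed by all naturals rather than by ordinals, so that the moments and
    the symmetric part can be computed by arithmetic on the indices. *)
Definition toeplitz_entry (i j : nat) : R :=
  if (j <= i.+1)%N then wcoef alpha (i.+1 - j)%N else 0.

(** Up to the common factor I(alpha), every entry is the Fourier coefficient of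
    index i - j of the symbol; the entries that vanish correspond to moments
    that vanish. *)
Lemma toeplitz_entry_moment (i j : nat) : 1 < alpha ->
  cos_moment alpha alpha * toeplitz_entry i j =
  (-1) ^+ i * (-1) ^+ j *
  (mu * cos_moment alpha (alpha - 2 * (i%:R - j%:R)) -
   lambda * cos_moment alpha (alpha - 2 - 2 * (i%:R - j%:R))).
Proof.
move=> alpha1; rewrite /toeplitz_entry.
case: (leqP j i) => [ji|ij].
  rewrite leqW // -(subnK ji); set n := (i - j)%N.
  rewrite natrD addrK -addSn addnK exprD -[_ * _ * (-1) ^+ j]mulrA.
  rewrite -expr2 sqrr_sign mulr1.
  rewrite cos_moment_gcoef //.
  have -> : alpha - 2 - 2 * n%:R = alpha - 2 * n.+1%:R by rewrite -natr1; ring.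
  rewrite cos_moment_gcoef // exprS.
  rewrite -[wcoef _ _]/(lambda * gcoef alpha n.+1 + mu * gcoef alpha n).
  move: (gcoef alpha n.+1) => g1; have := sqrr_sign R n.
  by move: ((-1) ^+ n) => e e2; ring: e2.
rewrite -(subnKC ij) addSn; case: (j - i.+1)%N => [|k].
  rewrite addn0 leqnn subnn /= -(natr1 i).
  have -> : alpha - 2 * (i%:R - (i%:R + 1)) = alpha + 2 * 1%:R by ring.
  have -> : alpha - 2 - 2 * (i%:R - (i%:R + 1)) = alpha by ring.
  rewrite cos_moment_out // exprS.
  by have := sqrr_sign R i; move: ((-1) ^+ i) => e e2; ring: e2.
rewrite leqNgt ltnS -addn1 leq_add2l /= mulr0.
have -> : alpha - 2 * (i%:R - (i + k.+1).+1%:R) = alpha + 2 * k.+2%:R.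
  by rewrite -[k.+2]addn2 -[(i + _).+1]addn1 -[k.+1]addn1 !natrD; ring.
have -> : alpha - 2 - 2 * (i%:R - (i + k.+1).+1%:R) = alpha + 2 * k.+1%:R.
  by rewrite -[(i + _).+1]addn1 -[k.+1]addn1 !natrD; ring.
by rewrite !cos_moment_out // !mulr0 subrr mulr0.
Qed.

(** Real and imaginary parts of p + i r, the symbol of minus the matrix divided
    by (2 cos t)^alpha. *)
Definition symbol_re t : R :=
  lambda * cos ((alpha - 2) * t) - mu * cos (alpha * t).
Definition symbol_im t : R :=
  lambda * sin ((alpha - 2) * t) - mu * sin (alpha * t).

(** The difference vanishes at s = 0 and its derivative is
    2 c (1 - c) sin(s/2) sin((1 - 2 c) s/2), nonnegative up to s = 2 pi. *)
Lemma sin_comparison (c s : R) :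
  0 <= c -> c <= 1 / 2 -> 0 <= s -> s <= 2 * pi ->
  c * sin ((1 - c) * s) <= (1 - c) * sin (c * s).
Proof.
move=> c0 c2 s0 s2.
pose f x : R := (1 - c) * sin (c * x) - c * sin ((1 - c) * x).
pose df x : R :=
  (1 - c) * (cos (c * x) * c) - c * (cos ((1 - c) * x) * (1 - c)).
have dsinM (a x : R) :
    is_derive x 1 (fun x : R => sin (a * x)) (cos (a * x) * a).
  apply: (@is_derive1_comp _ sin (fun x => a * x)).
  by apply: is_derive_eq; rewrite /GRing.scale/= mulr1.
have cf : continuous f.
  have -> : f = (fun x => (1 - c) * sin (c * x) + (- c) * sin ((1 - c) * x)).
    by apply/funext => x; rewrite mulNr.
  by apply: continuous_add; exact/continuous_scale/continuous_sinM.
have fdf x : x \in `]0, s[ -> is_derive x 1 f (df x).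
  move=> _; have d3 := is_deriveB (is_deriveZ (1 - c) (dsinM c x))
    (is_deriveZ c (dsinM (1 - c) x)).
  by refine (is_derive_eq d3 _).
have [x xs e] := MVT_segment s0 fdf (continuous_subspaceT cf).
suff : 0 <= f s - f 0 by rewrite /f !mulr0 sin0 !mulr0 subrr subr0 subr_ge0.
rewrite e subr0 mulr_ge0 //.
move: xs; rewrite in_itv/= => /andP[x0 xs].
have -> : df x = c * (1 - c) * (2 * (sin (x / 2) * sin ((1 - 2 * c) * x / 2))).
  rewrite /df.
  have -> : c * x = x / 2 - (1 - 2 * c) * x / 2 by field.
  have -> : (1 - c) * x = x / 2 + (1 - 2 * c) * x / 2 by field.
  by rewrite cosB cosD; ring.
have cx : 0 <= c * x by exact: mulr_ge0.
have cx2 : 0 <= (1 / 2 - c) * x by apply: mulr_ge0 => //; lra.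
do 3 (try apply: mulr_ge0) => //; try lra;
  by apply: sin_ge0_pi; lra.
Qed.

Lemma varsigmaE : 1 < alpha -> alpha < 2 -> varsigma alpha = cos (mu * pi).
Proof.
move=> alpha1 alpha2.
rewrite /varsigma; have -> : lambda * pi = pi - mu * pi by field.
rewrite cosB cospi sinpi mul0r addr0 mulN1r normrN ger0_norm //.
have p0 := pi_gt0 R.
have m0 : 0 <= mu * pi by apply: mulr_ge0; lra.
have m1 : 0 <= (1 / 2 - mu) * pi by apply: mulr_ge0; lra.
by apply: cos_ge0_pihalf; lra.
Qed.

Lemma varsigma_gt0 : 1 < alpha -> alpha < 2 -> 0 < varsigma alpha.
Proof.
move=> alpha1 alpha2; rewrite varsigmaE //; apply: cos_gt0_pihalf.
have p0 := pi_gt0 R.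
have m0 : 0 < mu * pi by apply: mulr_gt0; lra.
have m1 : 0 < (1 / 2 - mu) * pi by apply: mulr_gt0; lra.
lra.
Qed.

(** With m = (2 - alpha) / 2, the two quantities sin(m pi) p +/- cos(m pi) r
    are the differences of [sin_comparison] for c = m at s = pi -/+ 2 t. *)
Lemma symbol_sector t : 1 < alpha -> alpha < 2 -> - (pi / 2) <= t <= pi / 2 ->
  varsigma alpha * `|symbol_im t| <= sin (mu * pi) * symbol_re t.
Proof.
move=> alpha1 alpha2 /andP[t1 t2].
rewrite varsigmaE //.
have h1 := @sin_comparison mu (pi - 2 * t) ltac:(lra) ltac:(lra)
  ltac:(lra) ltac:(lra).
have h2 := @sin_comparison mu (pi + 2 * t) ltac:(lra) ltac:(lra)
  ltac:(lra) ltac:(lra).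
have hp s : sin ((1 - mu) * s) = sin (pi - (1 - mu) * s).
  by rewrite sinB sinpi cospi; ring.
move: h1 h2; rewrite !hp /symbol_re /symbol_im.
have -> : pi - (1 - mu) * (pi - 2 * t) = mu * pi + alpha * t by field.
have -> : pi - (1 - mu) * (pi + 2 * t) = mu * pi - alpha * t by field.
have -> : mu * (pi - 2 * t) = mu * pi + (alpha - 2) * t by field.
have -> : mu * (pi + 2 * t) = mu * pi - (alpha - 2) * t by field.
have -> : 1 - mu = lambda by field.
rewrite !sinB !sinD => h1 h2.
by case: ger0P => _; lra.
Qed.
End ToeplitzSymbol.

(** * Sectoriality of the Toeplitz form *)

Section ToeplitzForm.
Context {R : realType} (alpha : R) {n : nat}.
Implicit Types (x y : 'I_n -> R) (t : R).

Notation J := half_period_int.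
Notation lambda := (alpha / 2).
Notation mu := ((2 - alpha) / 2).

Definition toeplitz_form x y : R :=
  \sum_(i < n) \sum_(j < n) x i * toeplitz_entry alpha i j * y j.

(** Real and imaginary parts of the discrete Fourier transform of x at the angle
    theta = 2 t + pi; the half turn is the sign (-1)^i. *)
Definition cos_sum x t : R := \sum_(i < n) (-1) ^+ i * x i * cos (2 * i%:R * t).
Definition sin_sum x t : R := \sum_(i < n) (-1) ^+ i * x i * sin (2 * i%:R * t).

(** The real part of (p + i r) conj(X) Y, for X and Y the transforms
    of x and y. *)
Definition symbol_form x y t : R :=
  symbol_re alpha t * (cos_sum x t * cos_sum y t + sin_sum x t * sin_sum y t) +
  symbol_im alpha t * (sin_sum x t * cos_sum y t - cos_sum x t * sin_sum y t).

Lemma symbol_formE x y t :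
  - symbol_form x y t = \sum_(i < n) \sum_(j < n)
    ((-1) ^+ i * (-1) ^+ j * x i * y j) *
    (mu * cos ((alpha - 2 * (i%:R - j%:R)) * t) -
     lambda * cos ((alpha - 2 - 2 * (i%:R - j%:R)) * t)).
Proof.
pose p := symbol_re alpha t; pose r := symbol_im alpha t.
pose u := - (p * cos_sum y t) + r * sin_sum y t.
pose v := - (r * cos_sum y t) - p * sin_sum y t.
transitivity (cos_sum x t * u + sin_sum x t * v).
  by rewrite /symbol_form /u /v -/p -/r; ring.
rewrite [cos_sum x t]/cos_sum [sin_sum x t]/sin_sum !mulr_suml -big_split /=.
apply: eq_bigr => i _; rewrite /u /v.
set ci := cos _; set si := sin _; pose xi := (-1) ^+ i * x i.
transitivity (xi * (- (p * ci) - r * si) * cos_sum y t +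
              xi * (r * ci - p * si) * sin_sum y t).
  by rewrite /xi; ring.
rewrite /cos_sum /sin_sum !mulr_sumr -big_split /=.
apply: eq_bigr => j _.
have -> : (alpha - 2 * (i%:R - j%:R)) * t =
  alpha * t - (2 * i%:R * t - 2 * j%:R * t) by ring.
have -> : (alpha - 2 - 2 * (i%:R - j%:R)) * t =
  (alpha - 2) * t - (2 * i%:R * t - 2 * j%:R * t) by ring.
rewrite (cosB (alpha * t)) (cosB ((alpha - 2) * t)).
rewrite (cosB (2 * i%:R * t)) (sinB (2 * i%:R * t)) -/ci -/si.
by rewrite /p /r /symbol_re /symbol_im /xi; ring.
Qed.

Lemma continuous_symbol_form x y : continuous (fun t => - symbol_form x y t).
Proof.
under [fun t => _]eq_fun do rewrite symbol_formE.
apply: continuous_sum => i; apply: continuous_sum => j.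
apply: continuous_scale; apply: continuous_add.
  exact/continuous_scale/continuous_cosM.
have -> : (fun t => - (lambda * cos ((alpha - 2 - 2 * (i%:R - j%:R)) * t))) =
  (fun t => (- lambda) * cos ((alpha - 2 - 2 * (i%:R - j%:R)) * t)).
  by apply/funext => t; rewrite mulNr.
exact/continuous_scale/continuous_cosM.
Qed.

(** Parseval identity for the Toeplitz form: the weight (cos t)^alpha is,
    up to a constant, the modulus of (1 - e^(i theta))^alpha, the factor of the
    symbol that p + i r leaves out. *)
Lemma toeplitz_form_integral x y : 1 < alpha ->
  cos_moment alpha alpha * toeplitz_form x y =
  J (fun t => cos_weight alpha t * - symbol_form x y t).
Proof.
move=> alpha1; have alpha_gt0 : 0 < alpha by lra.
pose h (i j : 'I_n) (t : R) : R := ((-1) ^+ i * (-1) ^+ j * x i * y j) *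
  (mu * (cos_weight alpha t * cos ((alpha - 2 * (i%:R - j%:R)) * t)) +
   - lambda * (cos_weight alpha t * cos ((alpha - 2 - 2 * (i%:R - j%:R)) * t))).
have cw a b : continuous (fun t => a * (cos_weight alpha t * cos (b * t))).
  by apply/continuous_scale/continuous_weighted => //; exact: continuous_cosM.
have ch i j : continuous (h i j).
  by apply: continuous_scale; apply: continuous_add; exact: cw.
transitivity (J (fun t => \sum_i \sum_j h i j t)); last first.
  congr J; apply/funext => t; rewrite symbol_formE mulr_sumr.
  apply: eq_bigr => i _; rewrite mulr_sumr; apply: eq_bigr => j _.
  by rewrite /h; ring.
rewrite half_period_int_sum; last by move=> i; exact: continuous_sum.
rewrite /toeplitz_form mulr_sumr; apply: eq_bigr => i _.
rewrite half_period_int_sum // mulr_sumr; apply: eq_bigr => j _.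
have cw1 b : continuous (fun t => cos_weight alpha t * cos (b * t)).
  by apply/continuous_weighted => //; exact: continuous_cosM.
rewrite /h half_period_intZ; last by apply: continuous_add; exact: cw.
rewrite half_period_intD // !half_period_intZ // -!/(cos_moment _ _).
transitivity (x i * y j * (cos_moment alpha alpha * toeplitz_entry alpha i j)).
  by ring.
by rewrite toeplitz_entry_moment //; ring.
Qed.

(** Cauchy-Schwarz at each frequency: |p + i r| varsigma <= p by the sector
    condition, and 2 |a| |b| |X| |Y| <= a^2 |X|^2 + b^2 |Y|^2. *)
Lemma symbol_form_sector (a b t : R) x y : 1 < alpha -> alpha < 2 ->
  - (pi / 2) <= t <= pi / 2 ->
  2 * a * b * varsigma alpha * - symbol_form x y t <=
  a ^+ 2 * symbol_form x x t + b ^+ 2 * symbol_form y y t.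
Proof.
move=> alpha1 alpha2 ht; have := symbol_sector alpha1 alpha2 ht.
have p0 := pi_gt0 R.
have m0 : 0 < mu * pi by apply: mulr_gt0; lra.
have m1 : 0 < (1 / 2 - mu) * pi by apply: mulr_gt0; lra.
have S0 : 0 < sin (mu * pi) by apply: sin_gt0_pi; lra.
have C0 := varsigma_gt0 alpha1 alpha2.
have : varsigma alpha ^+ 2 + sin (mu * pi) ^+ 2 = 1.
  by rewrite varsigmaE // cos2Dsin2.
rewrite /symbol_form.
move: (varsigma alpha) (sin (mu * pi)) C0 S0 => C S C0 S0.
move: (symbol_re alpha t) (symbol_im alpha t) => p r CS sec.
move: (cos_sum x t) (sin_sum x t) (cos_sum y t) (sin_sum y t) => x1 x2 y1 y2.
have Sp : 0 <= S * p by apply: le_trans sec; rewrite mulr_ge0 // ltW.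
have p_ge0 : 0 <= p by rewrite pmulr_rge0 in Sp.
have sec2 : C ^+ 2 * r ^+ 2 <= S ^+ 2 * p ^+ 2.
  rewrite -!exprMn -(real_normK (num_real (C * r))) normrM (gtr0_norm C0).
  by rewrite lerXn2r // nnegrE // mulr_ge0 // ltW.
have [p00|pn0] := eqVneq p 0.
  have : C * `|r| <= 0 by rewrite p00 mulr0 in sec.
  rewrite pmulr_rle0 // normr_le0 => /eqP ->; rewrite p00; lra.
have p_gt0 : 0 < p by rewrite lt_neqAle eq_sym pn0.
rewrite -subr_ge0 -(pmulr_rge0 _ p_gt0).
(* completing the square: z1 + i z2 = (p + i r) Y, and the remainder is
   nonnegative by the sector condition *)
pose z1 := p * y1 - r * y2; pose z2 := p * y2 + r * y1.
have -> : p * (a ^+ 2 * (p * (x1 * x1 + x2 * x2) + r * (x2 * x1 - x1 * x2)) +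
     b ^+ 2 * (p * (y1 * y1 + y2 * y2) + r * (y2 * y1 - y1 * y2)) -
     2 * a * b * C * - (p * (x1 * y1 + x2 * y2) + r * (x2 * y1 - x1 * y2))) =
  (p * a * x1 + b * C * z1) ^+ 2 + (p * a * x2 + b * C * z2) ^+ 2 +
  b ^+ 2 * (y1 ^+ 2 + y2 ^+ 2) * (S ^+ 2 * p ^+ 2 - C ^+ 2 * r ^+ 2).
  rewrite /z1 /z2.
  have -> : S ^+ 2 = 1 - C ^+ 2 by lra.
  by ring.
rewrite !addr_ge0 ?sqr_ge0 // mulr_ge0 ?subr_ge0 // mulr_ge0 ?sqr_ge0 //.
by rewrite addr_ge0 ?sqr_ge0.
Qed.

(** The polarized form of varsigma |<x, G y>| <= sqrt (E(x) E(y)), kept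
    with free weights a and b because in that form it is linear in the three
    integrands and follows from [symbol_form_sector] by monotonicity. *)
Lemma toeplitz_form_sector (a b : R) x y : 1 < alpha -> alpha < 2 ->
  2 * a * b * varsigma alpha * toeplitz_form x y <=
  a ^+ 2 * - toeplitz_form x x + b ^+ 2 * - toeplitz_form y y.
Proof.
move=> alpha1 alpha2; have alpha_gt0 : 0 < alpha by lra.
have m0 := cos_moment_self_gt0 alpha1 alpha2.
have cf u v : continuous (fun t => cos_weight alpha t * - symbol_form u v t).
  exact/continuous_weighted/continuous_symbol_form.
suff : a ^+ 2 * J (fun t => cos_weight alpha t * - symbol_form x x t) +
   (b ^+ 2 * J (fun t => cos_weight alpha t * - symbol_form y y t) +
    2 * a * b * varsigma alpha *
      J (fun t => cos_weight alpha t * - symbol_form x y t)) <= 0.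
  rewrite -!toeplitz_form_integral // -subr_ge0 => h.
  rewrite -subr_ge0 -(pmulr_rge0 _ m0); apply: le_trans h _.
  by rewrite le_eqVlt; apply/orP; left; apply/eqP; ring.
rewrite -!half_period_intZ // -!half_period_intD //; first last.
- exact: continuous_scale.
- exact: continuous_scale.
- by apply: continuous_add; exact: continuous_scale.
- exact: continuous_scale.
rewrite -[leRHS](@half_period_int0 R).
apply: le_half_period_int; last first.
- move=> t ht; have := symbol_form_sector a b x y alpha1 alpha2 ht.
  rewrite -subr_ge0 => h; have := mulr_ge0 (powR_ge0 `|cos t| alpha) h.
  rewrite -/(cos_weight alpha t); lra.
- exact: cst_continuous.
- apply: continuous_add; first exact: continuous_scale.
  by apply: continuous_add; exact: continuous_scale.
Qed.

End ToeplitzForm.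

(** * Discrete Dirichlet forms and convex multipliers *)

Section DirichletForm.
Context {R : realType}.
Implicit Types (h e : nat -> R) (K : R).

Definition ndist (i j : nat) : nat := (i - j + (j - i))%N.

Lemma sum_around (F : nat -> R) (n i : nat) : (i < n)%N ->
  \sum_(j < n) F j = F i + \sum_(0 <= k < i) F (i - k.+1)%N +
    \sum_(0 <= k < n - i.+1) F (i + k.+1)%N.
Proof.
move=> ltin; rewrite -(big_mkord predT F).
rewrite (big_cat_nat (leq0n i) (ltnW ltin)) /=.
rewrite (big_ltn ltin) addrCA addrA; congr (_ + _ + _).
  by rewrite big_nat_rev /=; apply: eq_bigr => k _; rewrite add0n.
rewrite -{1}[i.+1]add0n big_addn; apply: eq_bigr => k _.
by congr F; lia.
Qed.

Lemma sum_nonpos_prefix (a : nat -> R) (m l : nat) : (m <= l)%N ->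
  (forall k, (k < l)%N -> a k <= 0) ->
  \sum_(0 <= k < l) a k <= \sum_(0 <= k < m) a k.
Proof.
move=> ml a0; rewrite (big_cat_nat (leq0n m) ml) /= gerDl big_nat_cond.
by apply: sumr_le0 => k /andP[/andP[_ kl] _]; exact: a0.
Qed.

(** The heart of the convexity argument. Of the neighbours of i, those at a
    distance at most m = min(i, n - 1 - i) come in symmetric pairs, for which
    e (i - k) + e (i + k) >= 2 e i; as h k <= 0 for k > 0, the others can be
    dropped. The right-hand side exceeds the bound so obtained by e i times the
    two-sided sum of the kernel up to the distance max(i, n - 1 - i). *)
Lemma kernel_convex_sum h e (n i : nat) : (i < n)%N ->
  (forall k, h k.+1 <= 0) ->
  (forall m, 0 <= h 0%N + 2 * \sum_(0 <= k < m) h k.+1) ->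
  (forall j, (j < n)%N -> 0 <= e j) ->
  (forall k, (k <= i)%N -> (i + k < n)%N ->
     2 * e i <= e (i - k)%N + e (i + k)%N) ->
  \sum_(j < n) h (ndist i j) * e j <= 2 * e i * \sum_(j < n) h (ndist i j).
Proof.
move=> ltin h_le0 h_tot e_ge0 e_conv.
rewrite (sum_around (fun j => h (ndist i j) * e j) ltin).
rewrite (sum_around (fun j => h (ndist i j)) ltin).
have -> : ndist i i = 0%N by rewrite /ndist; lia.
have Dl (k : nat) : (k < i)%N -> ndist i (i - k.+1) = k.+1.
  by rewrite /ndist; lia.
have Dr k : ndist i (i + k.+1) = k.+1 by rewrite /ndist; lia.
have El : \sum_(0 <= k < i) h (ndist i (i - k.+1)) * e (i - k.+1)%N =
          \sum_(0 <= k < i) h k.+1 * e (i - k.+1)%N.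
  by apply: eq_big_nat => k /andP[_ ki]; rewrite Dl.
have Er : \sum_(0 <= k < n - i.+1) h (ndist i (i + k.+1)) * e (i + k.+1)%N =
          \sum_(0 <= k < n - i.+1) h k.+1 * e (i + k.+1)%N.
  by apply: eq_bigr => k _; rewrite Dr.
have El1 : \sum_(0 <= k < i) h (ndist i (i - k.+1)) = \sum_(0 <= k < i) h k.+1.
  by apply: eq_big_nat => k /andP[_ ki]; rewrite Dl.
have Er1 : \sum_(0 <= k < n - i.+1) h (ndist i (i + k.+1)) =
           \sum_(0 <= k < n - i.+1) h k.+1.
  by apply: eq_bigr => k _; rewrite Dr.
rewrite {}El {}Er {}El1 {}Er1.
set r := (n - i.+1)%N; pose m := minn i r.
have hl : \sum_(0 <= k < i) h k.+1 * e (i - k.+1)%N <=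
          \sum_(0 <= k < m) h k.+1 * e (i - k.+1)%N.
  apply: sum_nonpos_prefix => [|k ki]; first exact: geq_minl.
  by rewrite mulr_le0_ge0 // e_ge0 //; lia.
have hr : \sum_(0 <= k < r) h k.+1 * e (i + k.+1)%N <=
          \sum_(0 <= k < m) h k.+1 * e (i + k.+1)%N.
  apply: sum_nonpos_prefix => [|k ki]; first exact: geq_minr.
  by rewrite mulr_le0_ge0 // e_ge0 //; move: ki; rewrite /r; lia.
have hm : \sum_(0 <= k < m) h k.+1 * e (i - k.+1)%N +
          \sum_(0 <= k < m) h k.+1 * e (i + k.+1)%N <=
          2 * e i * \sum_(0 <= k < m) h k.+1.
  rewrite -big_split mulr_sumr /= !big_nat; apply: ler_sum => k /andP[_ km].
  rewrite -mulrDr mulrC; apply: ler_wnM2r => //; apply: e_conv.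
    by move: km; rewrite /m /r; lia.
  by move: km; rewrite /m /r; lia.
have e0 := e_ge0 _ ltin.
have tot : 0 <= e i * (h 0%N + 2 * \sum_(0 <= k < maxn i r) h k.+1).
  by rewrite mulr_ge0.
have : \sum_(0 <= k < m) h k.+1 + \sum_(0 <= k < maxn i r) h k.+1 =
       \sum_(0 <= k < i) h k.+1 + \sum_(0 <= k < r) h k.+1.
  by rewrite /m; case: leqP => _ //; rewrite addrC.
move: hl hr hm tot.
move: (\sum_(0 <= k < maxn i r) h k.+1) (\sum_(0 <= k < m) h k.+1) => Hx Hm.
move: (\sum_(0 <= k < i) h k.+1) (\sum_(0 <= k < r) h k.+1) => Hi Hr.
move=> hl hr hm tot eH.
have -> : 2 * e i * (h 0%N + Hi + Hr) = 2 * e i * (h 0%N + Hm + Hx).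
  by rewrite -!addrA -eH.
lra.
Qed.

(** In e_i e_j y_i y_j, replace y_i y_j by the half of
    y_i^2 + y_j^2 - (y_i - y_j)^2. The differences contribute at most K^2 times
    their share of the form of y because h <= 0 off the diagonal; the squares
    contribute at most 2 K^2 times theirs by [kernel_convex_sum]. *)
Lemma dirichlet_convex_multiplier (n : nat) h e (y : 'I_n -> R) K :
  (forall k, h k.+1 <= 0) ->
  (forall m, 0 <= h 0%N + 2 * \sum_(0 <= k < m) h k.+1) ->
  (forall j, (j < n)%N -> 0 <= e j <= K) ->
  (forall i k, (k <= i)%N -> (i + k < n)%N ->
     2 * e i <= e (i - k)%N + e (i + k)%N) ->
  \sum_(i < n) \sum_(j < n) h (ndist i j) * (e i * y i) * (e j * y j) <=
  2 * K ^+ 2 * \sum_(i < n) \sum_(j < n) h (ndist i j) * y i * y j.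
Proof.
move=> h_le0 h_tot e_bd e_conv.
have e_ge0 j : (j < n)%N -> 0 <= e j by move/e_bd => /andP[].
have dC i j : ndist i j = ndist j i by rewrite /ndist addnC.
have polar (g : nat -> nat -> R) : (forall i j, g i j = g j i) ->
    \sum_(i < n) \sum_(j < n) g i j * y i * y j =
    \sum_(i < n) (y i ^+ 2 * \sum_(j < n) g i j) -
    2^-1 * \sum_(i < n) \sum_(j < n) g i j * (y i - y j) ^+ 2.
  move=> gC.
  have -> : \sum_(i < n) (y i ^+ 2 * \sum_(j < n) g i j) =
    2^-1 * \sum_(i < n) \sum_(j < n) g i j * (y i ^+ 2 + y j ^+ 2).
    under [in RHS]eq_bigr => i _.
      under eq_bigr do rewrite mulrDr; rewrite big_split /=; over.
    rewrite big_split /= [X in _ * (_ + X)]exchange_big /=.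
    have -> : \sum_(j < n) \sum_(i < n) g i j * y j ^+ 2 =
              \sum_(i < n) \sum_(j < n) g i j * y i ^+ 2.
      by do 2 (apply: eq_bigr => ? _); rewrite gC.
    have -> : \sum_(i < n) \sum_(j < n) g i j * y i ^+ 2 =
              \sum_(i < n) (y i ^+ 2 * \sum_(j < n) g i j).
      apply: eq_bigr => i _; rewrite mulr_sumr.
      by apply: eq_bigr => j _; rewrite mulrC.
    by field.
  rewrite -mulrBr -sumrB mulr_sumr; apply: eq_bigr => i _.
  rewrite -sumrB mulr_sumr; apply: eq_bigr => j _; by field.
have -> : \sum_(i < n) \sum_(j < n) h (ndist i j) * (e i * y i) * (e j * y j) =
    \sum_(i < n) \sum_(j < n) (h (ndist i j) * e i * e j) * y i * y j.
  by do 2 (apply: eq_bigr => ? _); ring.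
rewrite (polar (fun i j => h (ndist i j) * e i * e j)); last first.
  by move=> i j; rewrite dC; ring.
rewrite (polar (fun i j => h (ndist i j))) => [|i j]; last by rewrite dC.
rewrite mulrBr; apply: lerB.
  rewrite mulr_sumr; apply: ler_sum => i _.
  have /andP[e0 eK] := e_bd i (ltn_ord i).
  have hs := kernel_convex_sum (ltn_ord i) h_le0 h_tot e_ge0 (e_conv i).
  set s := \sum_(j < n) h (ndist i j) in hs *.
  have s0 : 0 <= s.
    (* the row sum is at most twice itself: the case of a constant function *)
    rewrite /s.
    have := @kernel_convex_sum h (fun=> 1) n i (ltn_ord i) h_le0 h_tot.
    under [X in _ -> _ -> X <= _]eq_bigr do rewrite mulr1.
    rewrite -/s => /(_ (fun _ _ => ler01)) H.
    have : s <= 2 * 1 * s by apply: H => k _ _; lra.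
    lra.
  have -> : \sum_(j < n) h (ndist i j) * e i * e j =
            e i * \sum_(j < n) h (ndist i j) * e j.
    by rewrite mulr_sumr; apply: eq_bigr => j _; ring.
  rewrite [leRHS]mulrCA; apply: ler_wpM2l; first exact: sqr_ge0.
  apply: (@le_trans _ _ (e i * (2 * e i * s))); first exact: ler_wpM2l.
  have -> : e i * (2 * e i * s) = 2 * e i ^+ 2 * s by ring.
  apply: ler_wpM2r => //; apply: ler_wpM2l => //.
  by rewrite lerXn2r // nnegrE (le_trans e0).
rewrite [leLHS]mulrCA; apply: ler_wpM2l; first by rewrite invr_ge0.
rewrite mulr_sumr; apply: ler_sum => i _; rewrite mulr_sumr.
apply: ler_sum => j _.
have [->|ij] := eqVneq i j; first by rewrite subrr expr0n /= !mulr0.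
rewrite mulrA; apply: ler_wpM2r; first exact: sqr_ge0.
have [k ->] : exists k, ndist i j = k.+1.
  by exists (ndist i j).-1; move: ij; rewrite -val_eqE /= /ndist; lia.
rewrite -mulrA mulrC; apply: ler_wnM2l => //.
have /andP[ei0 eiK] := e_bd i (ltn_ord i).
have /andP[ej0 ejK] := e_bd j (ltn_ord j).
have : e i * e j <= K * K by exact: ler_pM.
have : 0 <= K * K by apply: mulr_ge0; exact: le_trans ei0 eiK.
by rewrite expr2; lra.
Qed.

End DirichletForm.

(** * The symmetric part of the Toeplitz matrix *)

Section ToeplitzKernel.
Context {R : realType} (alpha : R).
Implicit Types (k : nat) (K : R).

Notation mu := ((2 - alpha) / 2).

Lemma gcoefS_mul k :
  k.+1%:R * gcoef alpha k.+1 = (k%:R - alpha) * gcoef alpha k.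
Proof.
have k0 : k.+1%:R != 0 :> R by rewrite pnatr_eq0.
by rewrite /= mulrA; congr (_ * _); move: k0; rewrite -natr1 => k0; field.
Qed.

Lemma gcoef_ge0 k : 1 < alpha -> alpha < 2 -> 0 <= gcoef alpha k.+2.
Proof.
move=> a1 a2; elim: k => [|k ih].
  rewrite /= ; have -> : (1 - (alpha + 1) / 2) * ((1 - (alpha + 1) / 1) * 1) =
    alpha * (alpha - 1) / 2 by field.
  by rewrite divr_ge0 // mulr_ge0; lra.
rewrite -(pmulr_rge0 _ (ltr0Sn R k.+2)) gcoefS_mul mulr_ge0 //.
by rewrite -addn2 natrD; have := ler0n R k; lra.
Qed.

(** The entries of the symmetric part of minus the Toeplitz matrix, as a
    function of the distance to the diagonal; the distance 1 is special because
    the matrix has a single superdiagonal. *)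
Definition sym_kernel k : R :=
  match k with
  | 0 => - wcoef alpha 1
  | 1 => - (wcoef alpha 0 + wcoef alpha 2) / 2
  | k'.+2 => - wcoef alpha k'.+3 / 2
  end.

Lemma toeplitz_entry_sym (i j : nat) :
  toeplitz_entry alpha i j + toeplitz_entry alpha j i =
  - 2 * sym_kernel (ndist i j).
Proof.
wlog ij : i j / (i <= j)%N.
  move=> H; have [/H //|/ltnW/H] := leqP i j.
  by rewrite addrC /ndist addnC.
rewrite -(subnKC ij); move: (j - i)%N => d.
have -> : ndist i (i + d) = d by rewrite /ndist; lia.
rewrite /toeplitz_entry.
have -> : (i <= (i + d).+1)%N by lia.
have -> : ((i + d).+1 - i = d.+1)%N by lia.
case: d => [|[|d]].
- by rewrite addn0 leqnSn subSnn /=; field.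
- by rewrite addn1 leqnn subnn /=; field.
- have -> : (i + d.+2 <= i.+1)%N = false by lia.
  rewrite add0r -[sym_kernel _]/(- wcoef alpha d.+3 / 2).
  by move: (wcoef _ _) => w; field.
Qed.

Lemma sym_kernel_le0 k : 1 < alpha -> alpha < 2 -> sym_kernel k.+1 <= 0.
Proof.
move=> a1 a2; case: k => [|k].
  have : 0 <= alpha * ((alpha + 2) * (alpha - 1)).
    by rewrite !mulr_ge0 //; lra.
  rewrite /=.
  lra.
have g2 := gcoef_ge0 k a1 a2; have g3 := gcoef_ge0 k.+1 a1 a2.
have : 0 <= alpha / 2 * gcoef alpha k.+3 by rewrite mulr_ge0 //; lra.
have : 0 <= mu * gcoef alpha k.+2 by rewrite mulr_ge0 //; lra.
rewrite -[sym_kernel _]/(- (alpha / 2 * gcoef alpha k.+3 +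
                            mu * gcoef alpha k.+2) / 2).
lra.
Qed.

(** The partial sums of the g_k telescope: alpha (g_0 + ... + g_n) is
    - (n + 1) g_(n + 1). This is the corresponding closed form for w_k. *)
Lemma sym_kernel_sum (m : nat) : alpha != 0 ->
  sym_kernel 0 + 2 * \sum_(0 <= k < m.+1) sym_kernel k.+1 =
  2^-1 * (m.+3%:R * gcoef alpha m.+3) +
  mu / alpha * (m.+2%:R * gcoef alpha m.+2).
Proof.
move=> a0; elim: m => [|m ih].
  by rewrite big_nat1 !gcoefS_mul /=; field.
rewrite big_nat_recr // mulrDr addrA ih.
rewrite -[sym_kernel _]/(- (alpha / 2 * gcoef alpha m.+3 +
                            mu * gcoef alpha m.+2) / 2).
rewrite [X in _ = 2^-1 * X + _]gcoefS_mul [X in _ = _ + _ * X]gcoefS_mul.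
by move: (gcoef alpha m.+3) (gcoef alpha m.+2) => g3 g2; field.
Qed.

Lemma sym_kernel_total (m : nat) : 1 < alpha -> alpha < 2 ->
  0 <= sym_kernel 0 + 2 * \sum_(0 <= k < m) sym_kernel k.+1.
Proof.
move=> a1 a2; case: m => [|m].
  rewrite big_nil mulr0 addr0 /=.
  have : 0 <= (alpha + 2) * (alpha - 1) by apply: mulr_ge0; lra.
  lra.
rewrite sym_kernel_sum; last by apply: lt0r_neq0; lra.
have g2 := gcoef_ge0 m a1 a2; have g3 := gcoef_ge0 m.+1 a1 a2.
move: (gcoef alpha m.+3) (gcoef alpha m.+2) g2 g3 => u v v0 u0.
have c0 : 0 <= mu / alpha by apply: divr_ge0; lra.
by apply: addr_ge0; apply: mulr_ge0 => //; exact: mulr_ge0.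
Qed.

Lemma toeplitz_form_kernel (n : nat) (x : 'I_n -> R) :
  - toeplitz_form alpha x x =
  \sum_(i < n) \sum_(j < n) sym_kernel (ndist i j) * x i * x j.
Proof.
pose s := toeplitz_form alpha x x.
have sE : s = \sum_(i < n) \sum_(j < n) x i * toeplitz_entry alpha j i * x j.
  rewrite /s /toeplitz_form exchange_big /=.
  by do 2 (apply: eq_bigr => ? _); ring.
have -> : - toeplitz_form alpha x x = - 2^-1 * (s + s) by rewrite /s; field.
rewrite {2}sE /s /toeplitz_form -big_split /= mulr_sumr; apply: eq_bigr => i _.
rewrite -big_split /= mulr_sumr; apply: eq_bigr => j _.
rewrite -!mulrA -mulrDr -mulrDl toeplitz_entry_sym; by field.
Qed.

Lemma toeplitz_form_le0 (n : nat) (x : 'I_n -> R) : 1 < alpha -> alpha < 2 ->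
  0 <= - toeplitz_form alpha x x.
Proof.
move=> a1 a2; have := toeplitz_form_sector 1 0 x x a1 a2; lra.
Qed.

(** Sectoriality with x = e y, followed by E(e y) <= 2 K^2 E(y). *)
Lemma toeplitz_form_multiplier (n : nat) (e : nat -> R) K (x : 'I_n -> R) :
  1 < alpha -> alpha < 2 ->
  (forall j, (j < n)%N -> 0 <= e j <= K) ->
  (forall i k, (k <= i)%N -> (i + k < n)%N ->
     2 * e i <= e (i - k)%N + e (i + k)%N) ->
  varsigma alpha * `|toeplitz_form alpha (fun i => e i * x i) x| <=
  Num.sqrt 2 * K * - toeplitz_form alpha x x.
Proof.
move=> a1 a2 e_bd e_conv.
have s2 : (Num.sqrt 2 : R) ^+ 2 = 2 by rewrite sqr_sqrtr.
have s0 : 0 < Num.sqrt 2 :> R by rewrite sqrtr_gt0.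
have E0 := toeplitz_form_le0 x a1 a2.
have D : - toeplitz_form alpha (fun i => e i * x i) (fun i => e i * x i) <=
    2 * K ^+ 2 * - toeplitz_form alpha x x.
  rewrite !toeplitz_form_kernel.
  apply: dirichlet_convex_multiplier => // [k|m].
    exact: sym_kernel_le0.
  exact: sym_kernel_total.
case: n x e_bd e_conv E0 D => [|n] x e_bd e_conv E0 D.
  by rewrite /toeplitz_form !big_ord0 normr0 oppr0 !mulr0.
have /andP[e0 eK] := e_bd 0%N isT.
have K0 : 0 <= K := le_trans e0 eK.
have [K00|Kn0] := eqVneq K 0.
  have -> : toeplitz_form alpha (fun i => e i * x i) x = 0.
    rewrite /toeplitz_form !big1 // => i _; rewrite big1 // => j _.
    have := e_bd i (ltn_ord i); rewrite K00 -eq_le => /eqP <-.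
    by rewrite !mul0r.
  by rewrite normr0 K00 !mulr0 mul0r.
have K_gt0 : 0 < K by rewrite lt_neqAle eq_sym Kn0.
have S0 : 0 < 2 * (Num.sqrt 2 * K) by rewrite !mulr_gt0.
rewrite -(ler_pM2l S0).
(* a = 1 and b = +/- sqrt 2 K balance the two terms of the sector bound *)
have main b : b ^+ 2 = 2 * K ^+ 2 ->
    2 * 1 * b * varsigma alpha * toeplitz_form alpha (fun i => e i * x i) x <=
    4 * K ^+ 2 * - toeplitz_form alpha x x.
  move=> b2; have := toeplitz_form_sector 1 b (fun i => e i * x i) x a1 a2.
  rewrite b2; lra.
have m1 := main (Num.sqrt 2 * K) ltac:(by rewrite exprMn s2).
have m2 := main (- (Num.sqrt 2 * K)) ltac:(by rewrite sqrrN exprMn s2).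
have -> : 2 * (Num.sqrt 2 * K) * (Num.sqrt 2 * K * - toeplitz_form alpha x x) =
   4 * K ^+ 2 * - toeplitz_form alpha x x.
  transitivity (2 * Num.sqrt 2 ^+ 2 * K ^+ 2 * - toeplitz_form alpha x x).
    by ring.
  by rewrite s2; ring.
rewrite mulrA; case: ger0P => _; lra.
Qed.

End ToeplitzKernel.

(** * Singular values and condition number from a relative norm bound *)

Section RelativeBounds.
Context {R : realType} {n : nat}.
Implicit Types (A B C P : 'M[R]_n) (v y : 'cV[R]_n) (s S : R).

Definition sqnorm v : R := \sum_(i < n) v i ord0 ^+ 2.

Lemma sqnorm_ge0 v : 0 <= sqnorm v.
Proof. by apply: sumr_ge0 => i _; exact: sqr_ge0. Qed.

Lemma sqnorm_eq0 v : sqnorm v = 0 -> v = 0.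
Proof.
move/eqP; rewrite psumr_eq0 => [|i _]; last exact: sqr_ge0.
move/allP => h; apply/colP => i; rewrite mxE.
by apply/eqP; rewrite -sqrf_eq0; apply: h; rewrite mem_index_enum.
Qed.

Lemma sqnormE v : (v^T *m v) ord0 ord0 = sqnorm v.
Proof. by rewrite mxE; apply: eq_bigr => i _; rewrite mxE expr2. Qed.

Lemma unitmx_of_ker B : (forall y, B *m y = 0 -> y = 0) -> B \in unitmx.
Proof.
move=> kerB; rewrite -unitmx_tr -row_free_unit -kermx_eq0.
apply/eqP/row_matrixP => i; rewrite row0; set v := row i _.
have vB : v *m B^T = 0.
  by rewrite /v -row_mul mulmx_ker row0.
apply: trmx_inj; rewrite trmx0; apply: kerB.
by rewrite -[B]trmxK -trmx_mul vB trmx0.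
Qed.

Lemma unitmx_of_sqnorm B s : 0 < s ->
  (forall y, s * sqnorm y <= sqnorm (B *m y)) -> B \in unitmx.
Proof.
move=> s0 sB; apply: unitmx_of_ker => y By; apply: sqnorm_eq0.
apply/eqP; rewrite eq_le sqnorm_ge0 andbT -(pmulr_rle0 _ s0).
apply: le_trans (sB y) _; rewrite By /sqnorm big1 // => i _.
by rewrite mxE expr0n.
Qed.

(** For an eigenvector v of C^T C with eigenvalue l, |C v|^2 = l |v|^2. *)
Lemma sq_singular_values_bounds C s S :
  (forall y, s * sqnorm y <= sqnorm (C *m y) <= S * sqnorm y) -> 0 <= s ->
  sq_singular_values C `<=` `[s, S]%classic.
Proof.
move=> sCS s0 _ [_ [l /eigenvalueP[v vl vn0] <-] <-] /=.
have e : sqnorm (C *m v^T) = l * sqnorm v^T.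
  rewrite -!sqnormE trmx_mul !trmxK mulmxA -(mulmxA v) vl.
  by rewrite -scalemxAl mxE.
have v0 : 0 < sqnorm v^T.
  rewrite lt_neqAle sqnorm_ge0 andbT eq_sym; apply: contra vn0 => /eqP h.
  by rewrite -(trmxK v) (sqnorm_eq0 h) trmx0.
have := sCS v^T; rewrite e !ler_pM2r // => /andP[sl lS].
by rewrite sqr_sqrtr ?in_itv/= ?sl // (le_trans s0).
Qed.

(** Nonnegativity is what lets two such bounds be multiplied in
    [cond2_bound]. *)
Lemma norm2_bounds C b : (0 < n)%N -> 0 <= b ->
  (forall y, sqnorm (C *m y) <= b * sqnorm y) -> 0 <= norm2 C <= Num.sqrt b.
Proof.
move=> n0 b0 Cb; rewrite /norm2; set E := (X in sup X).
pose v0 : 'cV[R]_n := delta_mx (Ordinal n0) ord0.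
have v0_unit : l2norm v0 = 1.
  rewrite /l2norm (bigD1 (Ordinal n0)) //= big1 ?addr0; last first.
    by move=> i /negPf i0; rewrite mxE i0 expr0n.
  by rewrite mxE !eqxx expr1n sqrtr1.
have Ev0 : E (l2norm (C *m v0)) by exists v0.
have ubE : ubound E (Num.sqrt b).
  move=> _ [v /= v1 <-]; rewrite /l2norm; apply: ler_wsqrtr.
  apply: le_trans (Cb v) _.
  suff -> : sqnorm v = 1 by rewrite mulr1.
  by rewrite -[LHS]sqr_sqrtr ?sqnorm_ge0 // -/(l2norm v) v1 expr1n.
apply/andP; split; last by apply: ge_sup => //; exists (l2norm (C *m v0)).
apply: (@le_trans _ _ (l2norm (C *m v0))); first exact: sqrtr_ge0.
by apply: ub_le_sup => //; exists (Num.sqrt b).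
Qed.

Lemma relative_sqnorm_bounds A P s S : P \in unitmx ->
  (forall y, s * sqnorm (P *m y) <= sqnorm (A *m y) <= S * sqnorm (P *m y)) ->
  forall y, s * sqnorm y <= sqnorm (A *m invmx P *m y) <= S * sqnorm y.
Proof.
by move=> uP h y; have := h (invmx P *m y); rewrite !mulmxA mulmxV // mul1mx.
Qed.

Lemma cond2_bound C s S : (0 < n)%N -> 0 < s -> s <= S ->
  (forall y, s * sqnorm y <= sqnorm (C *m y) <= S * sqnorm y) ->
  cond2 C <= Num.sqrt (S / s).
Proof.
move=> n0 s0 sS h; have S0 : 0 <= S by exact/ltW/(lt_le_trans s0).
have uC : C \in unitmx.
  by apply: (unitmx_of_sqnorm s0) => y; have /andP[] := h y.
have /andP[c0 c1] : 0 <= norm2 C <= Num.sqrt S.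
  by apply: norm2_bounds => // y; have /andP[] := h y.
have /andP[d0 d1] : 0 <= norm2 (invmx C) <= Num.sqrt s^-1.
  apply: norm2_bounds => // [|y]; first by rewrite invr_ge0 ltW.
  have /andP[+ _] := h (invmx C *m y); rewrite mulmxA mulmxV // mul1mx => hy.
  by rewrite -(ler_pM2l s0) mulrA mulfV ?gt_eqF // mul1r.
by rewrite /cond2 sqrtrM // ler_pM.
Qed.

End RelativeBounds.

(** * The discretized operator and its preconditioner *)

Lemma sqnorm_perturb (R : realType) (n : nat) (y z w : 'cV[R]_n)
    (t : R) (c : 'I_n -> R) :
  (forall i, w i ord0 = y i ord0 - t * (c i * z i ord0)) ->
  sqnorm w = sqnorm y - 2 * t * (\sum_i c i * y i ord0 * z i ord0) +
    t ^+ 2 * \sum_i c i ^+ 2 * z i ord0 ^+ 2.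
Proof.
move=> we; rewrite /sqnorm !mulr_sumr -sumrB -big_split /=.
by apply: eq_bigr => i _; rewrite we; ring.
Qed.

Section Discretized.
Context {R : realType} (xL xR T alpha kmin kmax : R) (d : R -> R).

Notation eta := (etapar xL xR T alpha).
Notation node := (grid xL xR).
Notation nu := (nucoef alpha kmin kmax).

Lemma etapar_ge0 N M : xL < xR -> 0 < T -> 0 <= eta N M.
Proof.
move=> hx hT; have tau0 : 0 <= taustep T N by apply: divr_ge0 => //; exact: ltW.
by apply: divr_ge0 => //; apply: mulr_ge0 => //; exact: powR_ge0.
Qed.

Lemma grid_in M i : xL < xR -> (0 < i)%N -> (i <= M)%N ->
  xL < node M i /\ node M i < xR.
Proof.
move=> hx i0 iM; rewrite /grid /hstep.
have M0 : 0 < M.+1%:R :> R by [].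
have d0 : 0 < xR - xL by rewrite subr_gt0.
split; first by rewrite ltrDl mulr_gt0 ?divr_gt0 ?ltr0n.
rewrite -ltrBrDl mulrCA gtr_pMr // ltr_pdivrMr // mul1r ltr_nat.
by rewrite ltnS.
Qed.

(** The nodes are equispaced, so node i is the midpoint of the nodes i - k
    and i + k. *)
Lemma grid_convex M (i k : nat) : xL < xR ->
  @convex_function R R^o `]xL, xR[%classic d ->
  (k <= i)%N -> (i + k < M)%N ->
  2 * d (node M i.+1) <= d (node M (i - k).+1) + d (node M (i + k).+1).
Proof.
move=> hx cvx ki ikM.
have [l1 l2] := @grid_in M (i - k).+1 hx isT ltac:(lia).
have [r1 r2] := @grid_in M (i + k).+1 hx isT ltac:(lia).
have h0 : 0 <= 2^-1 :> R by rewrite invr_ge0.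
have h1 : 2^-1 <= 1 :> R by lra.
have := cvx (Itv01 h0 h1) (node M (i - k).+1) (node M (i + k).+1).
rewrite !inE /= !in_itv /= l1 l2 r1 r2 => /(_ isT isT).
set a := node M (i - k).+1; set b := node M (i + k).+1.
rewrite -[conv _ _ _]/(2^-1 * a + (1 - 2^-1) * b).
rewrite -[conv _ _ _]/(2^-1 * d a + (1 - 2^-1) * d b).
have -> : 2^-1 * a + (1 - 2^-1) * b = node M i.+1.
  rewrite /a /b /grid -(subnK ki); move: (i - k)%N => j.
  by rewrite addnK -!addnS !natrD -(natr1 k) -(natr1 j); field.
lra.
Qed.


Lemma Gmx_form M (x : 'I_M -> R) (y : 'cV[R]_M) :
  \sum_i x i * (Gmx alpha M *m y) i ord0 =
  toeplitz_form alpha x (fun i => y i ord0).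
Proof.
apply: eq_bigr => i _; rewrite mxE mulr_sumr.
by apply: eq_bigr => j _; rewrite !mxE mulrA.
Qed.

Lemma kmin_le_kmax : xL < xR ->
  (forall x : R, xL < x -> x < xR -> kmin <= d x /\ d x <= kmax) ->
  kmin <= kmax.
Proof.
move=> hx hd; have [] := hd ((xL + xR) / 2) ltac:(lra) ltac:(lra).
exact: le_trans.
Qed.

Lemma dbar_bounds M : xL < xR -> (0 < M)%N ->
  (forall x : R, xL < x -> x < xR -> kmin <= d x /\ d x <= kmax) ->
  kmin <= dbar xL xR d M <= kmax.
Proof.
move=> hx M0 hd; have M0' : 0 < M%:R :> R by rewrite ltr0n.
have cst (c : R) : \sum_(1 <= i < M.+1) c = c * M%:R.
  by rewrite sumr_const_nat subn1 mulr_natr.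
have hn i : (1 <= i < M.+1)%N -> kmin <= d (node M i) <= kmax.
  move=> /andP[i1 iM]; have [l r] := grid_in hx i1 iM.
  by have [-> ->] := hd _ l r.
rewrite /dbar ler_pdivlMr // ler_pdivrMr // -!cst !big_nat.
by apply/andP; split; apply: ler_sum => i /hn /andP[].
Qed.

Lemma scheck_le1 : 0 < kmin -> kmin <= kmax -> scheck alpha kmin kmax <= 1.
Proof.
move=> k0 kk; rewrite /scheck ge_min; apply/orP; right.
have kmax0 := lt_le_trans k0 kk.
by rewrite ler_pdivrMr ?exprn_gt0 // mul1r lerXn2r // nnegrE ltW.
Qed.

Lemma shat_ge1 : 0 < kmin -> kmin <= kmax -> 1 <= shat alpha kmin kmax.
Proof.
move=> k0 kk; rewrite /shat le_max; apply/orP; right.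
have kmax0 := lt_le_trans k0 kk.
by rewrite ler_pdivlMr ?exprn_gt0 // mul1r lerXn2r // nnegrE ltW.
Qed.

(** The term by term comparison of |A y|^2 with |P y|^2; the first terms, both
    equal to |y|^2, are covered because scheck <= 1 <= shat. *)
Lemma AP_sqnorm_bounds N M (y : 'cV[R]_M) :
  xL < xR -> 0 < T -> 1 < alpha -> alpha < 2 -> 0 < kmin ->
  (forall x : R, xL < x -> x < xR -> kmin <= d x /\ d x <= kmax) ->
  0 < kmin - nu ->
  @convex_function R R^o `]xL, xR[%classic d -> (0 < M)%N ->
  [/\ sqnorm y <= sqnorm (Pmx xL xR T alpha d N M *m y),
      scheck alpha kmin kmax * sqnorm (Pmx xL xR T alpha d N M *m y) <=
        sqnorm (Amx xL xR T alpha d N M *m y)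
    & sqnorm (Amx xL xR T alpha d N M *m y) <=
        shat alpha kmin kmax * sqnorm (Pmx xL xR T alpha d N M *m y)].
Proof.
move=> hx hT a1 a2 k0 hd hnu cvx M0.
have kk := kmin_le_kmax hx hd.
have kmax0 := lt_le_trans k0 kk.
have /andP[db1 db2] := dbar_bounds hx M0 hd.
have eta0 := etapar_ge0 N M hx hT.
have C0 := varsigma_gt0 a1 a2.
pose z := Gmx alpha M *m y.
pose dn (j : nat) := d (node M j.+1).
have dn_bd j : (j < M)%N -> kmin <= dn j <= kmax.
  move=> jM; have [l r] := @grid_in M j.+1 hx isT jM.
  by have [h1 h2] := hd _ l r; rewrite h1.
pose E := - toeplitz_form alpha (fun i => y i ord0) (fun i => y i ord0).
have E0 : 0 <= E by exact: toeplitz_form_le0.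
pose W := toeplitz_form alpha (fun i : 'I_M => (dn i - kmin) * y i ord0)
                              (fun i => y i ord0).
have hW : `|W| <= nu * E.
  rewrite /nucoef mulrAC ler_pdivlMr // mulrC.
  apply: (@toeplitz_form_multiplier _ alpha M (fun j => dn j - kmin))
    => // [j jM|i k ki ikM].
    by have /andP[h1 h2] := dn_bd j jM; rewrite subr_ge0 h1 lerD2r.
  by have := grid_convex hx cvx ki ikM; rewrite /dn; lra.
have /andP[W1 W2] : - (nu * E) <= W <= nu * E by rewrite -ler_norml.
pose Z := \sum_i z i ord0 ^+ 2.
have Z0 : 0 <= Z by apply: sumr_ge0 => i _; exact: sqr_ge0.
pose Zd := \sum_(i < M) dn i ^+ 2 * z i ord0 ^+ 2.
have Zd1 : kmin ^+ 2 * Z <= Zd.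
  rewrite mulr_sumr; apply: ler_sum => i _.
  have /andP[h1 h2] := dn_bd i (ltn_ord i).
  by rewrite ler_wpM2r ?sqr_ge0 // lerXn2r // nnegrE ltW // (lt_le_trans k0).
have Zd2 : Zd <= kmax ^+ 2 * Z.
  rewrite mulr_sumr; apply: ler_sum => i _.
  have /andP[h1 h2] := dn_bd i (ltn_ord i).
  by rewrite ler_wpM2r ?sqr_ge0 // lerXn2r // nnegrE ltW // (lt_le_trans k0).
pose t := eta N M; pose b := dbar xL xR d M.
have nP : sqnorm (Pmx xL xR T alpha d N M *m y) =
    sqnorm y + 2 * t * (b * E) + t ^+ 2 * (b ^+ 2 * Z).
  rewrite (@sqnorm_perturb _ _ y z _ t (fun=> b)); last first.
    move=> i; rewrite /Pmx mulmxBl mul1mx -scalemxAl -/z !mxE /z -/t -/b; ring.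
  rewrite -mulr_sumr -/Z; congr (_ + _).
  have -> : \sum_(i < M) b * y i ord0 * z i ord0 = - (b * E).
    rewrite /E mulrN opprK -Gmx_form mulr_sumr.
    by apply: eq_bigr => i _; rewrite mulrA.
  by ring.
have nA : sqnorm (Amx xL xR T alpha d N M *m y) =
    sqnorm y + 2 * t * (kmin * E - W) + t ^+ 2 * Zd.
  rewrite (@sqnorm_perturb _ _ y z _ t (fun i => dn i)); last first.
    move=> i; rewrite /Amx mulmxBl mul1mx -scalemxAl -mulmxA -/z.
    by rewrite /Dmx mul_diag_mx !mxE.
  rewrite -/Zd; congr (_ + _).
  have -> : \sum_(i < M) dn i * y i ord0 * z i ord0 = W - kmin * E.
    rewrite /E /W -!Gmx_form mulrN opprK mulr_sumr -big_split.
    by apply: eq_bigr => i _; rewrite -/z /=; ring.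
  by ring.
have Y0 := sqnorm_ge0 y.
have t0 : 0 <= t by [].
have b0 : 0 < b by exact: lt_le_trans db1.
have t20 : 0 <= 2 * t by exact: mulr_ge0.
have tE : 0 <= 2 * t * E by exact: mulr_ge0.
have tZ : 0 <= t ^+ 2 * Z by rewrite mulr_ge0 ?sqr_ge0.
have b2 : kmin ^+ 2 <= b ^+ 2 by rewrite lerXn2r // nnegrE ltW.
have b3 : b ^+ 2 <= kmax ^+ 2 by rewrite lerXn2r // nnegrE ltW.
have tZd1 : t ^+ 2 * (kmin ^+ 2 * Z) <= t ^+ 2 * Zd.
  by rewrite ler_wpM2l ?sqr_ge0.
have tZd2 : t ^+ 2 * Zd <= t ^+ 2 * (kmax ^+ 2 * Z).
  by rewrite ler_wpM2l ?sqr_ge0.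
have tW1 : 2 * t * W <= 2 * t * (nu * E) by exact: ler_wpM2l t20 _ _ _.
have tW2 : 2 * t * - (nu * E) <= 2 * t * W by exact: ler_wpM2l t20 _ _ _.
split.
- have : 0 <= 2 * t * E * b by rewrite mulr_ge0 // ltW.
  have : 0 <= t ^+ 2 * Z * b ^+ 2 by rewrite mulr_ge0 // sqr_ge0.
  rewrite nP; lra.
- have := scheck_le1 k0 kk; set s := scheck _ _ _ => s1.
  have s0 : 0 <= s.
    by rewrite /s /scheck le_min !divr_ge0 ?sqr_ge0 // ltW.
  have sk : s * b <= kmin - nu.
    apply: (@le_trans _ _ (s * kmax)); first exact: ler_wpM2l.
    by rewrite -ler_pdivlMr // /s /scheck ge_min lexx.
  have sk2 : s * b ^+ 2 <= kmin ^+ 2.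
    apply: (@le_trans _ _ (s * kmax ^+ 2)); first exact: ler_wpM2l.
    by rewrite -ler_pdivlMr ?exprn_gt0 // /s /scheck ge_min lexx orbT.
  have h1 : s * sqnorm y <= sqnorm y by rewrite ler_piMl.
  have h2 := ler_wpM2l tE sk; have h3 := ler_wpM2l tZ sk2.
  rewrite nP nA; lra.
- have := shat_ge1 k0 kk; set s := shat _ _ _ => s1.
  have s0 : 0 <= s by exact: le_trans s1.
  have sk : kmin + nu <= s * b.
    apply: (@le_trans _ _ (s * kmin)); last exact: ler_wpM2l.
    by rewrite -ler_pdivrMr // /s /shat le_max lexx.
  have sk2 : kmax ^+ 2 <= s * b ^+ 2.
    apply: (@le_trans _ _ (s * kmin ^+ 2)); last exact: ler_wpM2l.
    by rewrite -ler_pdivrMr ?exprn_gt0 // /s /shat le_max lexx orbT.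
  have h1 : sqnorm y <= s * sqnorm y by rewrite ler_peMl.
  have h2 := ler_wpM2l tE sk; have h3 := ler_wpM2l tZ sk2.
  rewrite nP nA; lra.
Qed.

End Discretized.

(** * Spectral bounds for the preconditioned matrix *)
Theorem theorem2p5 (R : realType) (xL xR T alpha kmin kmax : R) (d : R -> R)
    (hx : xL < xR) (hT : 0 < T) (halpha1 : 1 < alpha) (halpha2 : alpha < 2)
    (hkmin : 0 < kmin) (hkmax : 0 < kmax)
    (hd : forall x : R, xL < x -> x < xR -> kmin <= d x /\ d x <= kmax)
    (hnu : 0 < kmin - nucoef alpha kmin kmax)
    (hconvex : @convex_function R R^o `]xL, xR[%classic d) :
  [/\ 0 < scheck alpha kmin kmax,
      0 < shat alpha kmin kmax,
      (forall N M : nat, (1 <= N)%N -> (1 <= M)%N ->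
        [/\ Pmx xL xR T alpha d N M \in unitmx,
            APinv xL xR T alpha d N M \in unitmx
          & sq_singular_values (APinv xL xR T alpha d N M) `<=`
            `[scheck alpha kmin kmax, shat alpha kmin kmax]%classic])
    & (ereal_sup [set (cond2 (APinv xL xR T alpha d NM.1 NM.2))%:E
                 | NM in [set NM : nat * nat | (1 <= NM.1)%N /\ (1 <= NM.2)%N]]
        <= (Num.sqrt (shat alpha kmin kmax / scheck alpha kmin kmax))%:E)%E].
Proof.
have kk := kmin_le_kmax hx hd.
have s0 : 0 < scheck alpha kmin kmax.
  by rewrite /scheck lt_min !divr_gt0 ?exprn_gt0.
have s1 := scheck_le1 alpha hkmin kk; have S1 := shat_ge1 alpha hkmin kk.
have bounds N M (M0 : (1 <= M)%N) y :=
  AP_sqnorm_bounds N y hx hT halpha1 halpha2 hkmin hd hnu hconvex M0.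
have uP N M : (1 <= M)%N -> Pmx xL xR T alpha d N M \in unitmx.
  move=> M0; apply: (unitmx_of_sqnorm ltr01) => y.
  by rewrite mul1r; have [] := bounds N M M0 y.
have APb N M (M0 : (1 <= M)%N) := relative_sqnorm_bounds (uP N M M0)
  (fun y => let: And3 _ h1 h2 := bounds N M M0 y in introT andP (conj h1 h2)).
split=> //; first exact: lt_le_trans S1.
  move=> N M _ M0; split; first exact: uP.
    by apply: (unitmx_of_sqnorm s0) => y; have /andP[] := APb N M M0 y.
  by apply: sq_singular_values_bounds (ltW s0) => y; exact: APb.
apply: ge_ereal_sup => _ [[N M] /= [_ M0] <-]; rewrite lee_fin.
by apply: cond2_bound => //; [exact: le_trans S1 | exact: APb].
Qed.
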